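(* Let $V$ be a vector space over $GF(2)$ of dimension $\omega$, let $A_1$ be a finite subspace of $V$ with $\mathsf{dim}(A_1)=n$, let $\pi:V\to A_1$ be a projection, and let $A$ be a finite subspace of $V$ with $A_1<A$. Let $\mathcal{K}_{A_1}$ be the set of all finite subspaces $U<V$ such that $\pi(U)$ contains $A_1$. Assume that the family of $n$-space-tuples (over $GF(2)$) has the Ramsey property. Then for any $r$ and any finite $B\in\mathcal{K}_{A_1}$ with $A<B$ there exists a finite $C\in\mathcal{K}_{A_1}$ such that for each $r$-coloring $\xi:{C\choose A}\to r$ there is a subspace $B'\le C$ with $B'\in\mathcal{K}_{A_1}$ and $B'$ isomorphic to $B$, such that $\xi$ is constant on ${B'\choose A}\cap\mathcal{K}_{A_1}$.
   Context: For finite vector spaces $A$ and $C$, ${C\choose A}$ is the set of all subspaces of $C$ isomorphic to $A$ (i.e. of the same dimension). A projection $\pi:V\to A_1$ is a linear map onto $A_1$ that is the identity on $A_1$. If $U$ is a finite subspace of a vector space and $v_1,\ldots,v_n$ is a sequence of vectors linearly independent over $U$, the tuple $(U+v_1,\ldots,U+v_n)$ is called an $n$-space-tuple based on $U$; its dimension is $\mathsf{dim}(U)$. For $n$-space-tuples, $(U+v_1,\ldots,U+v_n)<(W+v_1',\ldots,W+v_n')$ (the first is a subtuple of the second) means that each $U+v_i$ is an (affine) subspace of $W+v_i'$. The family of $n$-space-tuples has the Ramsey property if the following holds: for all $k,r,t\ge 0$ with $t<k$ there exists $m$ such that, whenever $X$ is an $m$-dimensional vector space over the field and $\xi$ is an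 $r$-coloring of the $n$-space-tuples in $X$ based on $t$-dimensional subspaces of $X$, there is an $n$-space-tuple in $X$ of dimension $k$, say $(W+v_1,\ldots,W+v_n)$, such that all its $n$-space subtuples of dimension $t$ have the same color. *)

(* Defs.v *)
From HB Require Import structures.
From mathcomp Require Import all_boot all_order all_algebra.
From mathcomp Require Import boolp classical_sets functions cardinality.

Set Implicit Arguments.
Unset Strict Implicit.
Unset Printing Implicit Defensive.

Import GRing.Theory.
Local Open Scope classical_set_scope.
Local Open Scope ring_scope.

(* Only the values of xi on S are relevant. *)
Definition coloring (T : Type) (S : set T) (r : nat) (xi : T -> nat) : Prop :=
  forall x, S x -> (xi x < r)%N.

Definition constant_on (T : Type) (S : set T) (xi : T -> nat) : Prop :=
  forall x y, S x -> S y -> xi x = xi y.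

Definition finite_subspace (F : fieldType) (V : lmodType F) (U : set V) : Prop :=
  GRing.submod_closed (mem U) /\ finite_set U.

Definition lin_indep (F : fieldType) (V : lmodType F) (I : choiceType)
    (b : I -> V) : Prop :=
  forall (s : seq I) (c : I -> F), uniq s ->
    \sum_(i <- s) c i *: b i = 0 -> forall i, i \in s -> c i = 0.

Definition lin_span (F : fieldType) (V : lmodType F) (I : choiceType)
    (b : I -> V) : set V :=
  [set v | exists (s : seq I) (c : I -> F), v = \sum_(i <- s) c i *: b i].

Definition is_basis (F : fieldType) (V : lmodType F) (I : choiceType)
    (U : set V) (b : I -> V) : Prop :=
  lin_indep b /\ lin_span b = U.

Definition has_dim (F : fieldType) (V : lmodType F) (U : set V) (d : nat) : Prop :=
  exists b : 'I_d -> V, is_basis U b.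

Definition has_dim_omega (F : fieldType) (V : lmodType F) : Prop :=
  exists b : nat -> V, is_basis [set: V] b.

Definition isomorphic (F : fieldType) (V : lmodType F) (U W : set V) : Prop :=
  exists f : V -> V,
    set_bij U W f /\
    forall (a : F) u v, U u -> U v -> f (a *: u + v) = a *: f u + f v.

(* Written "C choose A": the subspaces of C isomorphic to A. *)
Definition copies (F : fieldType) (V : lmodType F) (C A : set V) : set (set V) :=
  [set U | [/\ GRing.submod_closed (mem U), U `<=` C & isomorphic U A]].

Definition is_projection (F : fieldType) (V : lmodType F) (A1 : set V)
    (pi : {linear V -> V}) : Prop :=
  range pi = A1 /\ forall x, A1 x -> pi x = x.

Definition classK (F : fieldType) (V : lmodType F) (pi : V -> V) (A1 : set V) :
    set (set V) :=
  [set U | finite_subspace U /\ A1 `<=` pi @` U].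

Definition coset (F : fieldType) (X : vectType F) (U : {vspace X}) (v : X) : set X :=
  [set u + v | u in [set` U]].

Definition lin_indep_over (F : fieldType) (X : vectType F) (n : nat)
    (U : {vspace X}) (v : 'I_n -> X) : Prop :=
  forall c : 'I_n -> F, \sum_i c i *: v i \in U -> forall i, c i = 0.

(* The base is determined by the cosets as soon as 0 < n; it is recorded so that
   a 0-space-tuple is still based on a definite subspace. *)
Record space_tuple (F : fieldType) (X : vectType F) (n : nat) := SpaceTuple {
  st_base : {vspace X};
  st_coset : 'I_n -> set X;
  st_prop : exists v : 'I_n -> X,
    lin_indep_over st_base v /\ forall i, st_coset i = coset st_base (v i)
}.

Definition st_dim (F : fieldType) (X : vectType F) (n : nat)
  (T : space_tuple X n) : nat := \dim (st_base T).

(* The inclusion of the bases follows from that of the cosets when 0 < n. *)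
Definition subtuple (F : fieldType) (X : vectType F) (n : nat)
    (S T : space_tuple X n) : Prop :=
  (st_base S <= st_base T)%VS /\ forall i, st_coset S i `<=` st_coset T i.

(* F is finite, so all subspaces of a finite-dimensional X are finite. *)
Definition space_tuples_ramsey (F : finFieldType) (n : nat) : Prop :=
  forall k r t : nat, (t < k)%N ->
  exists m : nat, forall X : vectType F, \dim {:X} = m ->
  forall xi : space_tuple X n -> nat,
    coloring [set S | st_dim S = t] r xi ->
  exists T : space_tuple X n, st_dim T = k /\
    constant_on [set S | subtuple S T /\ st_dim S = t] xi.

(* Main.v *)
Require Import Defs.
From HB Require Import structures.
From mathcomp Require Import all_boot all_order all_algebra.
From mathcomp Require Import boolp classical_sets functions cardinality.

Set Implicit Arguments.
Unset Strict Implicit.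
Unset Printing Implicit Defensive.

Import GRing.Theory.
Local Open Scope classical_set_scope.
Local Open Scope ring_scope.

(** Let [n + t] and [n + k] be the dimensions of [A] and [B], and embed a space
    [X] of the dimension given by the Ramsey hypothesis for [k], [r], [t] into
    the kernel of [pi] by [f]; put C = A1 + f(X). With a basis a_1, ..., a_n of
    A1, a tuple (U + v_1, ..., U + v_n) codes the member of K spanned by f(U)
    and the a_i + f(v_i). Not every member of K inside C is coded, because the
    v_i must be independent over U. But if (W + v_1, ..., W + v_n) codes B',
    then any member of K inside B' is coded by a subtuple: its coset
    representatives lie in the W + v_i, so they inherit independence over W.
    Hence colouring tuples by the spaces that they code settles the case
    t < k, and for t = k one has A = B. *)

(** * Linear combinations and maps out of coordinate spaces *)

Definition lincomb (F : fieldType) (V : lmodType F) (n : nat) (v : 'I_n -> V)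
    (c : 'rV[F]_n) : V :=
  \sum_i c 0 i *: v i.

Lemma lincomb_is_linear (F : fieldType) (V : lmodType F) (n : nat)
    (v : 'I_n -> V) : linear (lincomb v).
Proof.
move=> a c d; rewrite /lincomb scaler_sumr -big_split /=.
by apply: eq_bigr => i _; rewrite !mxE scalerDl scalerA.
Qed.

HB.instance Definition _ (F : fieldType) (V : lmodType F) (n : nat)
    (v : 'I_n -> V) :=
  GRing.isLinear.Build F 'rV[F]_n V _ (lincomb v) (lincomb_is_linear v).

Lemma lincomb_delta (F : fieldType) (V : lmodType F) (n : nat) (v : 'I_n -> V)
    (i : 'I_n) : lincomb v 'e_i = v i.
Proof.
rewrite /lincomb (bigD1 i) //= mxE !eqxx scale1r big1 ?addr0 // => j /negPf ji.
by rewrite mxE ji andbF scale0r.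
Qed.

Lemma linear_lincomb (F : fieldType) (V W : lmodType F) (n : nat)
    (g : {linear V -> W}) (v : 'I_n -> V) (c : 'rV[F]_n) :
  g (lincomb v c) = lincomb (g \o v) c.
Proof. by rewrite /lincomb linear_sum; apply: eq_bigr => i _; rewrite linearZ. Qed.

Lemma linear_delta (F : fieldType) (V : lmodType F) (n : nat)
    (g : {linear 'rV[F]_n -> V}) (c : 'rV[F]_n) :
  g c = lincomb (fun i => g 'e_i) c.
Proof.
by rewrite [in LHS](row_sum_delta c) linear_sum; apply: eq_bigr => i _; rewrite linearZ.
Qed.

Lemma lincombD (F : fieldType) (V : lmodType F) (n : nat) (v w : 'I_n -> V)
    (c : 'rV[F]_n) : lincomb (fun i => v i + w i) c = lincomb v c + lincomb w c.
Proof. by rewrite /lincomb -big_split; apply: eq_bigr => i _; rewrite scalerDr. Qed.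

(** The map out of a direct sum induced by maps on its summands; it glues the coordinates of
    complementary subspaces. *)
Definition copair (F : fieldType) (V : lmodType F) (m n : nat)
    (f : 'rV[F]_m -> V) (g : 'rV[F]_n -> V) (x : 'rV[F]_(m + n)) : V :=
  f (lsubmx x) + g (rsubmx x).

Lemma copair_is_linear (F : fieldType) (V : lmodType F) (m n : nat)
    (f : {linear 'rV[F]_m -> V}) (g : {linear 'rV[F]_n -> V}) :
  linear (copair f g).
Proof. by move=> a x y; rewrite /copair !linearP scalerDr addrACA. Qed.

HB.instance Definition _ (F : fieldType) (V : lmodType F) (m n : nat)
    (f : {linear 'rV[F]_m -> V}) (g : {linear 'rV[F]_n -> V}) :=
  GRing.isLinear.Build F 'rV[F]_(m + n) V _ (copair f g) (copair_is_linear f g).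

Lemma copair_row_mx (F : fieldType) (V : lmodType F) (m n : nat)
    (f : 'rV[F]_m -> V) (g : 'rV[F]_n -> V) (x : 'rV[F]_m) (y : 'rV[F]_n) :
  copair f g (row_mx x y) = f x + g y.
Proof. by rewrite /copair row_mxKl row_mxKr. Qed.

Lemma copair_inj (F : fieldType) (V : lmodType F) (m n : nat)
    (f : {linear 'rV[F]_m -> V}) (g : {linear 'rV[F]_n -> V}) :
  (forall x y, f x + g y = 0 -> x = 0 /\ y = 0) -> injective (copair f g).
Proof.
move=> fg0; apply: raddf_inj => x /fg0[x1 x2].
by rewrite -[x]hsubmxK x1 x2 row_mx0.
Qed.

(** * Subspaces as sets *)

Lemma submod_setP (F : fieldType) (V : lmodType F) (U : set V) :
  GRing.submod_closed (mem U) <->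
  U 0 /\ forall (a : F) u v, U u -> U v -> U (a *: u + v).
Proof.
split=> [[/set_mem U0 lU]|[/mem_set U0 lU]]; split=> //.
  by move=> a u v /mem_set Uu /mem_set Uv; apply/set_mem/lU.
by move=> a u v /set_mem Uu /set_mem Uv; apply/mem_set/lU.
Qed.

Lemma submod_set0 (F : fieldType) (V : lmodType F) (U : set V) :
  GRing.submod_closed (mem U) -> U 0.
Proof. by case/submod_setP. Qed.

Lemma submod_setD (F : fieldType) (V : lmodType F) (U : set V) u v :
  GRing.submod_closed (mem U) -> U u -> U v -> U (u + v).
Proof. by case/submod_setP => _ lU Uu Uv; rewrite -[u]scale1r; apply: lU. Qed.

Lemma submod_setZ (F : fieldType) (V : lmodType F) (U : set V) (a : F) u :
  GRing.submod_closed (mem U) -> U u -> U (a *: u).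
Proof. by case/submod_setP => U0 lU Uu; rewrite -[_ *: _]addr0; apply: lU. Qed.

Lemma submod_setB (F : fieldType) (V : lmodType F) (U : set V) u v :
  GRing.submod_closed (mem U) -> U u -> U v -> U (u - v).
Proof.
by move=> cU Uu Uv; apply: submod_setD => //; rewrite -scaleN1r; apply: submod_setZ.
Qed.

Lemma submod_set_lincomb (F : fieldType) (V : lmodType F) (U : set V) (n : nat)
    (v : 'I_n -> V) (c : 'rV[F]_n) :
  GRing.submod_closed (mem U) -> (forall i, U (v i)) -> U (lincomb v c).
Proof.
move=> cU Uv; rewrite /lincomb; elim/big_ind: _ => [||i _].
- exact: submod_set0.
- by move=> x y; apply: submod_setD.
- exact: submod_setZ.
Qed.

Lemma submod_setI (F : fieldType) (V : lmodType F) (U W : set V) :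
  GRing.submod_closed (mem U) -> GRing.submod_closed (mem W) ->
  GRing.submod_closed (mem (U `&` W)).
Proof.
move=> /submod_setP[U0 lU] /submod_setP[W0 lW]; apply/submod_setP; split=> //.
by move=> a u v [Uu Wu] [Uv Wv]; split; [apply: lU|apply: lW].
Qed.

Definition kernel (F : fieldType) (V : lmodType F) (f : V -> V) : set V :=
  [set v | f v = 0].

Lemma submod_kernel (F : fieldType) (V : lmodType F) (f : {linear V -> V}) :
  GRing.submod_closed (mem (kernel f)).
Proof.
apply/submod_setP; split=> [|a u v]; rewrite /kernel /= ?linear0 //.
by move=> fu fv; rewrite linearP fu fv scaler0 addr0.
Qed.

Lemma submod_range (F : fieldType) (U V : lmodType F) (f : {linear U -> V}) :
  GRing.submod_closed (mem (range f)).
Proof.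
apply/submod_setP; split=> [|a u v]; first by exists 0; rewrite ?linear0.
by move=> [x _ <-] [y _ <-]; exists (a *: x + y); rewrite ?linearP.
Qed.

(** * Dimension by coordinates *)

(* Equivalent to [has_dim U d], but a finite [F] makes the coordinate space a
   finite type, so that dimensions can be compared by counting. *)
Definition coordinatized (F : fieldType) (V : lmodType F) (d : nat)
    (U : set V) : Prop :=
  exists2 g : {linear 'rV[F]_d -> V}, injective g & range g = U.

Lemma coordinatized_submod (F : fieldType) (V : lmodType F) d (U : set V) :
  coordinatized d U -> GRing.submod_closed (mem U).
Proof. by case=> g _ <-; apply: submod_range. Qed.

Lemma coordinatized_finite_set (F : finFieldType) (V : lmodType F) d
    (U : set V) : coordinatized d U -> finite_set U.
Proof. by case=> g _ <-; apply: finite_image; apply: finite_finset. Qed.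

Lemma coordinatized_finite (F : finFieldType) (V : lmodType F) d (U : set V) :
  coordinatized d U -> finite_subspace U.
Proof.
by move=> dU; split;
  [apply: coordinatized_submod dU|apply: coordinatized_finite_set dU].
Qed.

(** Inverting [h] on the range of [g] gives an injection of coordinate spaces, so cardinalities
    compare; for [d = e] an injection of a finite set into itself is onto. *)
Lemma coordinatized_sub (F : finFieldType) (V : lmodType F) d e (U W : set V) :
  coordinatized d U -> coordinatized e W -> U `<=` W ->
  (d <= e)%N /\ (d = e -> U = W).
Proof.
move=> [g gI <-] [h hI <-] gh.
have /choice[k hk] : forall x, exists y, h y = g x.
  by move=> x; have [y _ <-] := gh (g x) (imageT _ _); exists y.
have kI : injective k by move=> x y /(congr1 h); rewrite !hk => /gI.
split=> [|de].
  by move: (leq_card _ kI); rewrite !card_mx !mul1n leq_exp2l ?card_finNzRing_gt1.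
subst e; apply/seteqP; split=> // _ [y _ <-].
by have [k' _ kK] := injF_bij kI; exists (k' y); rewrite // -hk kK.
Qed.

Lemma coordinatized_uniq (F : finFieldType) (V : lmodType F) d e (U : set V) :
  coordinatized d U -> coordinatized e U -> d = e.
Proof.
move=> dU eU; apply/eqP; rewrite eqn_leq.
by rewrite (coordinatized_sub dU eU _).1 // (coordinatized_sub eU dU _).1.
Qed.

Lemma coordinatized_isomorphic (F : fieldType) (V : lmodType F) d
    (U W : set V) : coordinatized d U -> coordinatized d W -> isomorphic U W.
Proof.
move=> [g gI <-] [h hI <-].
(* [isomorphic] asks for a total map on [V], so the inverse of [g] gets the arbitrary value 0 off
   its range. *)
have /choice[k gk] : forall u, exists x, range g u -> g x = u.
  move=> u; have [[x _ <-]|nu] := pselect (range g u); first by exists x.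
  by exists 0.
have kg x : k (g x) = x by apply/gI/gk.
exists (h \o k); split; last first.
  by move=> a _ _ [x _ <-] [y _ <-] /=; rewrite !kg -(linearP g) kg linearP.
split=> [_ [x _ <-]||_ [x _ <-]]; first by exists (k (g x)).
- by move=> _ _ /set_mem[x _ <-] /set_mem[y _ <-] /=; rewrite !kg => /hI ->.
- by exists (g x); [exists x|rewrite /= kg].
Qed.

(** Coordinates on [W] are pulled back through [f]; the choice of preimages is linear because [f] is
    linear and injective on [U]. *)
Lemma isomorphic_coordinatized (F : fieldType) (V : lmodType F) d
    (U W : set V) :
  GRing.submod_closed (mem U) -> isomorphic U W -> coordinatized d W ->
  coordinatized d U.
Proof.
move=> /submod_setP[U0 lU] [f [[fUW fI fS] fL]] [g gI gW].
have /choice[k fk] : forall x, exists u, U u /\ f u = g x.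
  by move=> x; have [|u Uu <-] := fS (g x); [rewrite -gW; exists x|exists u].
have Uk x : U (k x) := (fk x).1.
have kL : linear k.
  move=> a x y; apply: fI; [exact/mem_set|exact/mem_set/lU|].
  by rewrite fL // !(fk _).2 linearP.
pose h : {linear 'rV[F]_d -> V} :=
  HB.pack k (GRing.isLinear.Build _ _ _ _ _ kL).
exists h; first by move=> x y /(congr1 f); rewrite !(fk _).2 => /gI.
apply/seteqP; split=> [_ [x _ <-] //|u Uu].
have : range g (f u) by rewrite gW; apply: fUW.
case=> x _ gx; exists x => //; apply: fI; [exact/mem_set|exact/mem_set|].
by rewrite (fk _).2.
Qed.

Lemma coordinatized_basis (F : fieldType) (V : lmodType F) d (U : set V) :
  has_dim U d -> coordinatized d U.
Proof.
case=> b [bI bU]; exists (lincomb b).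
  apply: raddf_inj => c /= c0; apply/rowP => i; rewrite mxE.
  by apply: (bI (index_enum _) (c 0)); rewrite ?index_enum_uniq ?mem_index_enum.
rewrite -bU; apply/seteqP; split=> [_ [c _ <-]|_ [s [c ->]]].
  by exists (index_enum _), (c 0).
elim/big_rec: _ => [|i _ _ [x _ <-]]; first by exists 0; rewrite ?linear0.
by exists (c i *: 'e_i + x); rewrite // linearP /= lincomb_delta.
Qed.

(** * Growing subspaces inside a given one *)

Lemma coordinatized0 (F : fieldType) (V : lmodType F) :
  coordinatized 0 [set 0 : V].
Proof.
exists (lincomb (fun=> 0)); first by move=> x y _; apply/rowP => -[].
apply/seteqP; split=> [_ [x _ <-]|_ ->]; first by rewrite /= /lincomb big_ord0.
by exists 0; rewrite ?linear0.
Qed.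

Lemma coordinatized_extend (F : fieldType) (V : lmodType F) d (U W : set V) :
  GRing.submod_closed (mem U) -> coordinatized d W -> W `<=` U -> W <> U ->
  exists2 W', coordinatized (d + 1) W' & W' `<=` U.
Proof.
move=> cU [g gI <-] gU ngU.
have [z Uz nz] : exists2 z, U z & ~ range g z.
  apply: contrapT => nz; apply: ngU; apply/seteqP; split=> // z Uz.
  by apply: contrapT => gz; apply: nz; exists z.
pose f := copair g (lincomb (fun _ : 'I_1 => z)).
exists (range f); first exists f => //.
  apply: copair_inj => x y /=; rewrite /lincomb big_ord1 => gxy.
  (* A nonzero coefficient could be divided out, putting [z] into the range of [g]. *)
  have y0 : y 0 0 = 0.
    apply/eqP/negPn/negP => y0; apply: nz; exists (- (y 0 0)^-1 *: x) => //.
    move/eqP: gxy; rewrite addr_eq0 => /eqP gx.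
    by rewrite linearZ /= gx scalerN scaleNr opprK scalerA mulVf ?scale1r.
  split; last by apply/rowP => i; rewrite ord1 y0 mxE.
  by apply: gI; rewrite linear0 -gxy y0 scale0r addr0.
move=> _ [x _ <-]; rewrite /f /copair; apply: submod_setD => //.
  by apply: gU; exists (lsubmx x).
by apply: submod_set_lincomb.
Qed.

(** Subspaces of [U] are grown one dimension at a time until [U] is exhausted or dimension [d] is
    reached. This serves both for finite subspaces and for the kernel of a projection. *)
Lemma coordinatized_or_large (F : fieldType) (V : lmodType F) (U : set V) d :
  GRing.submod_closed (mem U) ->
  (exists e, coordinatized e U) \/ (exists2 W, coordinatized d W & W `<=` U).
Proof.
move=> cU; elim: d => [|d [?|[W dW WU]]]; last 2 first.
- by left.
- have [WeU|nWU] := pselect (W = U); first by left; exists d; rewrite -WeU.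
  by right; rewrite -addn1; apply: coordinatized_extend dW WU nWU.
- by right; exists [set 0]; [apply: coordinatized0|move=> _ ->; apply: submod_set0].
Qed.

Lemma finite_coordinatized (F : finFieldType) (V : lmodType F) (U : set V) :
  finite_subspace U -> exists d, coordinatized d U.
Proof.
case=> cU /finite_seqP[s Us].
(* With [d] the length of the list [s], the second alternative would fit |F|^d > d vectors into
   [U]. *)
have [//|[W [g gI <-] gU]] := coordinatized_or_large (size s) cU.
have : (size (map g (enum 'rV[F]_(size s))) <= size s)%N.
  apply: uniq_leq_size => [|_ /mapP[x _ ->]].
    by rewrite map_inj_uniq ?enum_uniq.
  by have : U (g x) by [apply: gU; exists x]; rewrite Us.
by rewrite size_map -cardE card_mx mul1n leqNgt ltn_expl ?card_finNzRing_gt1.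
Qed.

Lemma has_dim_omega_not_coordinatized (F : finFieldType) (V : lmodType F) d :
  has_dim_omega V -> ~ coordinatized d [set: V].
Proof.
case=> b [bI _] dV; pose v (i : 'I_d.+1) := b i.
suff vI : injective (lincomb v).
  have vd : coordinatized d.+1 (range (lincomb v)) by exists (lincomb v).
  by have [] := coordinatized_sub vd dV (fun _ _ => I); rewrite ltnn.
apply: raddf_inj => c /= c0; apply/rowP => i; rewrite mxE.
(* [bI] takes coefficients on all of [nat], so [c] is extended by 0 beyond [d]. *)
have := bI (map val (index_enum 'I_d.+1)) (fun j => oapp (c 0) 0 (insub j)).
rewrite (map_inj_uniq val_inj) index_enum_uniq => /(_ isT).
rewrite big_map; under eq_bigr do rewrite valK /=.
move=> /(_ c0 (val i)); rewrite valK; apply.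
by rewrite (mem_map val_inj) mem_index_enum.
Qed.

(** * Subspaces of a [vectType], and splitting along a projection *)

Lemma vspace_coordinatized (F : fieldType) (X : vectType F) d (P : set X) :
  coordinatized d P -> exists U : {vspace X}, forall x, x \in U <-> P x.
Proof.
case=> g _ <-; exists (limg (linfun g)) => x; split.
  by case/memv_imgP => y _ ->; rewrite lfunE; exists y.
by case=> y _ <-; rewrite -(lfunE g) memv_img ?memvf.
Qed.

Lemma coordinatized_vspace (F : fieldType) (X : vectType F) (V : lmodType F)
    (f : {linear X -> V}) (U : {vspace X}) :
  injective f -> coordinatized (\dim U) (f @` [set` U]).
Proof.
move=> fI; pose e (i : 'I_(\dim U)) := (vbasis U)`_i.
exists (lincomb (f \o e)).
  apply: raddf_inj => c /=; rewrite -linear_lincomb -(linear0 f) => /fI c0.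
  apply/rowP => i; rewrite mxE.
  have := coord_sum_free (c 0) i (basis_free (vbasisP U)).
  by rewrite -/(lincomb e c) c0 linear0.
apply/seteqP; split=> [_ [c _ <-]|_ [x /= xU <-]] /=.
  rewrite -linear_lincomb; exists (lincomb e c) => //=.
  by apply: memv_suml => i _; rewrite memvZ // vbasis_mem // mem_nth ?size_tuple.
exists (\row_i coord (vbasis U) i x) => //.
rewrite -linear_lincomb [in RHS](coord_vbasis xU); congr (f _).
by apply: eq_bigr => i _; rewrite mxE.
Qed.

(** Lifts to [U] of a basis of [A1] span a complement of the kernel part of [U]. *)
Lemma coordinatized_split (F : fieldType) (V : lmodType F) (pi : {linear V -> V})
    (A1 U : set V) n t :
  is_projection A1 pi -> coordinatized n A1 -> GRing.submod_closed (mem U) ->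
  A1 `<=` pi @` U -> coordinatized t (U `&` kernel pi) ->
  coordinatized (n + t) U.
Proof.
move=> [piA1 _] [g gI gA1] cU A1U [h hI hU].
have /choice[u uP] : forall i, exists u, U u /\ pi u = g 'e_i.
  move=> i; have [|u Uu <-] := A1U (g 'e_i); last by exists u.
  by rewrite -gA1; exists 'e_i.
have piu c : pi (lincomb u c) = g c.
  rewrite linear_lincomb (linear_delta g).
  by apply: eq_bigr => i _; rewrite /= (uP i).2.
have Uh y : (U `&` kernel pi) (h y) by rewrite -hU; exists y.
exists (copair (lincomb u) h).
  apply: copair_inj => c y cy0.
  have c0 : c = 0.
    apply: gI; rewrite linear0 -piu -[in RHS](linear0 pi) -cy0 linearD.
    by rewrite (Uh y).2 addr0.
  by split=> //; apply: hI; rewrite linear0 -cy0 c0 linear0 add0r.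
apply/seteqP; split=> [_ [x _ <-]|z Uz].
  apply: submod_setD => //; last exact: (Uh _).1.
  by apply: submod_set_lincomb => // i; exact: (uP i).1.
(* The coordinates of [pi z] say which combination of lifts to subtract; the remainder lies in the
   kernel. *)
have [c _ gc] : range g (pi z) by rewrite gA1 -piA1; exists z.
have [y _ hy] : range h (z - lincomb u c).
  rewrite hU; split; last by rewrite /kernel /= linearB /= piu gc subrr.
  by apply: submod_setB => //; apply: submod_set_lincomb => // i; exact: (uP i).1.
by exists (row_mx c y); rewrite //= copair_row_mx hy addrC subrK.
Qed.

(** Were the kernel finite-dimensional, adding the [n] dimensions of [A1] would make [V]
    finite-dimensional. *)
Lemma coordinatized_kernel (F : finFieldType) (V : lmodType F)
    (pi : {linear V -> V}) (A1 : set V) n m :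
  has_dim_omega V -> is_projection A1 pi -> coordinatized n A1 ->
  exists2 W, coordinatized m W & W `<=` kernel pi.
Proof.
move=> hV hpi dA1.
have [[t dK]|//] := coordinatized_or_large m (submod_kernel pi).
have dV : coordinatized (n + t) [set: V].
  apply: (coordinatized_split hpi dA1); rewrite ?setTI //.
    by apply/submod_setP.
  by rewrite hpi.1.
by case: (has_dim_omega_not_coordinatized hV dV).
Qed.

(** * Spaces coded by tuples *)

(* The subspace of the paper coded by a space tuple: the basis vectors of A1,
   given by [al], are shifted by the representatives of the cosets. *)
Definition tuple_space (F : fieldType) (V : lmodType F) (X : vectType F)
    (n : nat) (al : 'rV[F]_n -> V) (f : X -> V) (S : space_tuple X n) : set V :=
  [set z | exists c w u, [/\ forall i, st_coset S i (w i), u \in st_base S &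
                             z = al c + f (lincomb w c + u)]].

(** The coded space computed from one choice of representatives [v]; a tuple itself records only
    cosets. *)
Definition amalgam (F : fieldType) (V : lmodType F) (X : vectType F)
    (n : nat) (al : 'rV[F]_n -> V) (f : X -> V) (U : {vspace X})
    (v : 'I_n -> X) : set V :=
  [set z | exists c, exists2 u, u \in U & z = al c + f (lincomb v c + u)].

(** Other representatives differ from [v] by vectors of the base, and a combination of these is
    absorbed into the summand [u]. *)
Lemma tuple_spaceE (F : fieldType) (V : lmodType F) (X : vectType F)
    (n : nat) (al : 'rV[F]_n -> V) (f : X -> V) (S : space_tuple X n)
    (v : 'I_n -> X) :
  (forall i, st_coset S i = coset (st_base S) (v i)) ->
  tuple_space al f S = amalgam al f (st_base S) v.
Proof.
move=> Sv; apply/seteqP; split=> [_ [c [w [u [wS uS ->]]]]|_ [c [u uS ->]]].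
  have /choice[u' u'P] : forall i, exists u', u' \in st_base S /\ u' + v i = w i.
    by move=> i; have := wS i; rewrite Sv => -[u' /= u'S <-]; exists u'.
  exists c, (lincomb u' c + u).
    by rewrite memvD //; apply: memv_suml => i _; rewrite memvZ // (u'P i).1.
  rewrite addrA -lincombD; congr (_ + f (_ + _)).
  by apply: eq_bigr => i _; rewrite addrC (u'P i).2.
exists c, v, u; split=> // i; rewrite Sv; exists 0; rewrite /= ?add0r //.
exact: mem0v.
Qed.

Lemma submod_amalgam (F : fieldType) (V : lmodType F) (X : vectType F)
    (n : nat) (al : {linear 'rV[F]_n -> V}) (f : {linear X -> V})
    (U : {vspace X}) (v : 'I_n -> X) :
  GRing.submod_closed (mem (amalgam al f U v)).
Proof.
apply/submod_setP; split=> [|a _ _ [c [u uU ->]] [d [w wU ->]]].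
  by exists 0, 0; rewrite ?mem0v // !linear0 addr0 linear0 addr0.
exists (a *: c + d), (a *: u + w); first by rewrite memvD ?memvZ.
rewrite scalerDr addrACA -(linearP al) -(linearP f).
by congr (_ + f _); rewrite linearP scalerDr addrACA.
Qed.

(** * Coded spaces under the projection *)

Section Amalgam.

Context (F : finFieldType) (V : lmodType F) (X : vectType F) (n : nat).
Context (pi : {linear V -> V}) (A1 : set V) (hpi : is_projection A1 pi).
Context (al : {linear 'rV[F]_n -> V}) (alI : injective al) (alA1 : range al = A1).
Context (f : {linear X -> V}) (fI : injective f) (pif : forall x, pi (f x) = 0).

Lemma projD c x : pi (al c + f x) = al c.
Proof. by rewrite linearD /= pif addr0 hpi.2 // -alA1; exists c. Qed.

Lemma amalgam_kernel (U : {vspace X}) (v : 'I_n -> X) :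
  amalgam al f U v `&` kernel pi = f @` [set` U].
Proof.
apply/seteqP; split=> [_ [[c [u uU ->]]]|_ [u /= uU <-]].
  rewrite /kernel /= projD -(linear0 al) => /alI ->.
  by exists u => //; rewrite !linear0 !add0r.
split; last exact: pif.
by exists 0, u => //; rewrite !linear0 !add0r.
Qed.

Lemma amalgam_proj (U : {vspace X}) (v : 'I_n -> X) :
  A1 `<=` pi @` amalgam al f U v.
Proof.
rewrite -alA1 => _ [c _ <-]; exists (al c + f (lincomb v c)); last exact: projD.
by exists c, 0; rewrite ?mem0v ?addr0.
Qed.

Lemma coordinatized_amalgam (U : {vspace X}) (v : 'I_n -> X) :
  coordinatized (n + \dim U) (amalgam al f U v).
Proof.
apply: (coordinatized_split hpi); first by exists al.
- exact: submod_amalgam.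
- exact: amalgam_proj.
- by rewrite amalgam_kernel; apply: coordinatized_vspace.
Qed.

(** [U0] is the part of [X] that [f] carries into [U], and [w i] comes from a lift to [U] of the
    [i]-th basis vector of [A1]. *)
Lemma amalgam_sub (W : {vspace X}) (v : 'I_n -> X) (U : set V) t :
  lin_indep_over W v -> GRing.submod_closed (mem U) ->
  A1 `<=` pi @` U -> U `<=` amalgam al f W v ->
  coordinatized t (U `&` kernel pi) ->
  exists (U0 : {vspace X}) (w : 'I_n -> X),
    [/\ lin_indep_over U0 w, (U0 <= W)%VS, \dim U0 = t,
        forall i, coset U0 (w i) `<=` coset W (v i) & U = amalgam al f U0 w].
Proof.
move=> vI cU A1U UW [g gI gU].
have gf s : exists x, x \in W /\ f x = g s.
  have : (U `&` kernel pi) (g s) by rewrite -gU; exists s.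
  move=> [/UW Wg kg].
  have : (amalgam al f W v `&` kernel pi) (g s) by [].
  by rewrite amalgam_kernel => -[x xW <-]; exists x.
have [h hP] := choice gf.
have hL : linear h.
  by move=> a x y; apply: fI; rewrite linearP !(hP _).2 linearP.
pose h' : {linear _ -> _} :=
  HB.pack h (GRing.isLinear.Build _ _ _ _ _ hL).
have hI : injective h by move=> x y /(congr1 f); rewrite !(hP _).2 => /gI.
have [|U0 U0P] := @vspace_coordinatized F X t (range h).
  by exists h'.
have U0U x : x \in U0 <-> U (f x).
  split=> [/U0P[s _ <-]|Ufx].
    have : (U `&` kernel pi) (g s) by rewrite -gU; exists s.
    by rewrite (hP s).2 => -[].
  apply/U0P; have : (U `&` kernel pi) (f x) by split=> //; exact: pif.
  by rewrite -gU => -[s _ gs]; exists s => //; apply: fI; rewrite (hP s).2.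
have U0W : (U0 <= W)%VS by apply/subvP => x /U0P[s _ <-]; exact: (hP s).1.
(* A lift of [al 'e_i] in [U] also lies in the amalgam over [W]; comparing projections forces its
   coefficients to be ['e_i], so its [X] part is in the coset of [v i]. *)
have /choice[w wP] i :
    exists w, U (al 'e_i + f w) /\ exists2 u, u \in W & w = u + v i.
  have [|z Uz piz] := A1U (al 'e_i); first by rewrite -alA1; exists 'e_i.
  have [c [u uW zE]] := UW z Uz.
  move: piz; rewrite zE projD => /alI cE.
  exists (u + v i); split; last by exists u.
  by rewrite -(lincomb_delta v i) [u + _]addrC -cE -zE.
have Uw c : U (al c + f (lincomb w c)).
  rewrite (linear_delta al) linear_lincomb -lincombD.
  by apply: submod_set_lincomb => // i; exact: (wP i).1.
exists U0, w; split=> //.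
(* As [v i] and [w i] differ by a vector of [W], and [U0] lies in [W], a relation among the [w i]
   modulo [U0] is one among the [v i] modulo [W]. *)
- move=> c cw; apply: vI.
  have /choice[u uP] i : exists u, u \in W /\ v i = w i - u.
    by have [_ [u uW ->]] := wP i; exists u; rewrite addrC addKr.
  under eq_bigr do rewrite (uP _).2 scalerBr.
  rewrite sumrB; apply: memvB; first exact: (subvP U0W).
  by apply: memv_suml => i _; rewrite memvZ // (uP i).1.
(* Dimensions are compared in [V]: the image of [U0] is exactly the kernel part of [U]. *)
- apply: (@coordinatized_uniq F V _ _ (f @` [set` U0])).
    exact: coordinatized_vspace.
  exists g => //; rewrite gU.
  apply/seteqP; split=> [z [Uz kz]|_ [x /= /U0U Ux <-]].
    have : (amalgam al f W v `&` kernel pi) z by split=> //; exact: UW.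
    by rewrite amalgam_kernel => -[x _ xz]; exists x => //=; apply/U0U; rewrite xz.
  by split=> //; exact: pif.
- move=> i _ [x /= xU0 <-]; have [_ [u uW ->]] := wP i.
  by exists (x + u); rewrite /= ?addrA // memvD // (subvP U0W).
apply/seteqP; split=> [z Uz|_ [c [u uU0 ->]]].
  have [c [u _ zE]] := UW z Uz.
  (* Subtracting from [z] the combination of lifts with the same [c] leaves a vector of [U] in the
     range of [f], hence the image of a vector of [U0]. *)
  exists c, (lincomb v c + u - lincomb w c); last first.
    by rewrite zE [lincomb w c + _]addrC subrK.
  apply/U0U; rewrite linearB /=.
  rewrite (_ : _ - _ = z - (al c + f (lincomb w c))); first exact: submod_setB.
  by rewrite zE opprD addrACA subrr add0r.
by rewrite linearD addrA; apply: submod_setD => //; apply/U0U.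
Qed.

Lemma classK_amalgam (U : {vspace X}) (v : 'I_n -> X) :
  classK pi A1 (amalgam al f U v).
Proof.
split; last exact: amalgam_proj.
exact: coordinatized_finite (coordinatized_amalgam U v).
Qed.

End Amalgam.

(** With all of [X] as base, a change of representatives is absorbed by the base, so one ambient
    space holds every coded space. *)
Lemma amalgam_fullv (F : fieldType) (V : lmodType F) (X : vectType F)
    (n : nat) (al : 'rV[F]_n -> V) (f : X -> V) (U : {vspace X})
    (v w : 'I_n -> X) :
  amalgam al f U v `<=` amalgam al f fullv w.
Proof.
move=> _ [c [u _ ->]]; exists c, (lincomb v c + u - lincomb w c).
  by rewrite memvf.
by rewrite [lincomb w c + _]addrC subrK.
Qed.

Lemma finite_subspace_kernel (F : fieldType) (V : lmodType F)
    (pi : {linear V -> V}) (U : set V) :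
  finite_subspace U -> finite_subspace (U `&` kernel pi).
Proof.
move=> [cU fU]; split; first exact: submod_setI (submod_kernel pi).
exact: sub_finite_set (@subIsetl _ _ _) fU.
Qed.


(** * The Ramsey argument *)

Theorem proposition3p8 (V : lmodType 'F_2) (hV : has_dim_omega V)
    (n : nat) (A1 : set V) (hA1 : finite_subspace A1) (hdim : has_dim A1 n)
    (pi : {linear V -> V}) (hpi : is_projection A1 pi)
    (A : set V) (hA : finite_subspace A) (hA1A : A1 `<=` A)
    (hR : space_tuples_ramsey 'F_2 n) :
  forall (r : nat) (B : set V), classK pi A1 B -> A `<=` B ->
  exists C : set V, classK pi A1 C /\
    forall xi : set V -> nat, coloring (copies C A) r xi ->
    exists B' : set V,
      [/\ B' `<=` C, classK pi A1 B', isomorphic B' B &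
          constant_on (copies B' A `&` classK pi A1) xi].
Proof.
move=> r B KB AB; have dA1 := coordinatized_basis hdim.
have [al alI alA1] := dA1.
have [t dAk] := finite_coordinatized (finite_subspace_kernel pi hA).
have [k dBk] := finite_coordinatized (finite_subspace_kernel pi KB.1).
have dA : coordinatized (n + t) A.
  apply: (coordinatized_split hpi dA1 hA.1 _ dAk) => x A1x.
  by exists x; [apply: hA1A|apply: hpi.2].
have dB := coordinatized_split hpi dA1 KB.1.1 KB.2 dBk.
have dcopy C U : copies C A U -> coordinatized (n + t) U.
  by case=> cU _ UA; apply: isomorphic_coordinatized UA dA.
have [] := coordinatized_sub dA dB AB; rewrite leq_add2l leq_eqVlt.
(* If [t = k], then [C = B' = B] works: by dimension the only copy of [A] in [B] is [B] itself. *)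
case/orP => [/eqP tk _|tk _].
  exists B; split=> // xi _; exists B; split=> //.
    exact: (coordinatized_isomorphic dB dB).
  have copyB U : copies B A U -> U = B.
    move=> UA; have [_ UB _] := UA.
    by apply: (coordinatized_sub (dcopy _ _ UA) dB UB).2; rewrite tk.
  by move=> U W [/copyB -> _] [/copyB -> _].
have [m hm] := hR k r t tk.
have [_ [f fI <-] fk] := coordinatized_kernel m hV hpi dA1.
have pif x : pi (f x) = 0 by apply: fk; exists x.
(* This is [A1 + f(X)] with [X = 'rV_m]; over the full base, zero representatives suffice. *)
exists (amalgam al f fullv (fun=> 0)); split; first exact: classK_amalgam.
move=> xi hxi; have [||T [dT constT]] := hm 'rV_m _ (xi \o tuple_space al f).
- by rewrite dimvf /dim /= mul1n.
(* A tuple of dimension [t] codes a space of dimension [n + t] inside [C], thus a copy of [A], whose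
   colour is below [r]. *)
- move=> S dS; apply: hxi; have [v [_ Sv]] := st_prop S.
  rewrite (tuple_spaceE _ _ Sv); split.
  + exact: submod_amalgam.
  + exact: amalgam_fullv.
  + apply: (coordinatized_isomorphic _ dA); rewrite -dS.
    exact: (coordinatized_amalgam hpi).
have [v [vI Tv]] := st_prop T.
exists (amalgam al f (st_base T) v); split.
- exact: amalgam_fullv.
- exact: classK_amalgam.
- by apply: (coordinatized_isomorphic _ dB); rewrite -dT; exact: (coordinatized_amalgam hpi).
have subT U : (copies (amalgam al f (st_base T) v) A `&` classK pi A1) U ->
    exists S, [/\ subtuple S T, st_dim S = t & tuple_space al f S = U].
  move=> [UA KU]; have [cU UT _] := UA.
  have [t' dU] := finite_coordinatized (finite_subspace_kernel pi KU.1).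
  (* Splitting gives [U] dimension [n + t'], while a copy of [A] has dimension [n + t]. *)
  have tt' : t' = t.
    apply/(@addnI n); apply: coordinatized_uniq (dcopy _ _ UA).
    exact: coordinatized_split KU.2 dU.
  rewrite {}tt' in dU.
  have [U0 [w [wI U0T dU0 wT ->]]] :=
    amalgam_sub hpi alI alA1 fI pif vI cU KU.2 UT dU.
  have wP : exists w', lin_indep_over U0 w' /\
    forall i, coset U0 (w i) = coset U0 (w' i).
    by exists w.
  exists (SpaceTuple wP); split=> //; last exact: tuple_spaceE.
  by split=> // i; rewrite Tv; exact: wT.
by move=> U W /subT[S [ST dS <-]] /subT[S' [ST' dS' <-]]; apply: constT.
Qed.
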